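(* Let $(\mathcal A_1,\mathcal H_1,D_1,\gamma_1)$ and $(\mathcal A_2,\mathcal H_2,D_2,\gamma_2)$ be even spectral triples which are $k$-summable and $\ell$-summable respectively, and let $\mathcal E_1=p_1\mathcal A_1^m$, $\mathcal E_2=p_2\mathcal A_2^n$ be Hermitian finitely generated projective modules over $\mathcal A_1,\mathcal A_2$. Let $$\alpha=\frac{n\,\Gamma(\frac k2+1)\Gamma(\frac \ell2+1)}{\Gamma(\frac{k+\ell}{2}+1)}Tr_\omega(|D_2|^{-\ell}),\qquad \beta=\frac{m\,\Gamma(\frac k2+1)\Gamma(\frac \ell2+1)}{\Gamma(\frac{k+\ell}{2}+1)}Tr_\omega(|D_1|^{-k}).$$ For $\nabla_j\in C(\mathcal E_j)$ put $\nabla=\nabla_1\otimes1+1\otimes\nabla_2$. Then additivity is a stronger condition than subadditivity: if $\mathcal{YM}(\nabla)=\alpha\,\mathcal{YM}(\nabla_1)+\beta\,\mathcal{YM}(\nabla_2)$ for all $\nabla_j\in C(\mathcal E_j)$, then $\sqrt{\mathcal{YM}(\nabla)}\le\sqrt\alpha\sqrt{\mathcal{YM}(\nabla_1)}+\sqrt\beta\sqrt{\mathcal{YM}(\nabla_2)}$ for all $\nabla_j\in C(\mathcal E_j)$.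
   Context: All algebras are unital; $\otimes$ without subscript is over $\mathbb C$. A spectral triple $(\mathcal A,\mathcal H,D)$ consists of a unital associative $\star$-algebra $\mathcal A$ with a unital faithful $\star$-representation $\pi$ on a separable Hilbert space $\mathcal H$ and an unbounded self-adjoint operator $D$ on $\mathcal H$ with compact resolvent such that each $[D,\pi(a)]$ extends to a bounded operator; $\mathcal A$ is identified with $\pi(\mathcal A)$. The algebras of the given spectral triples are assumed stable under the holomorphic functional calculus in a unital $C^*$-algebra. The triple is even if there is $\gamma=\gamma^*\in\mathcal B(\mathcal H)$, $\gamma^2=1$, commuting with $\mathcal A$ and anticommuting with $D$. It is $d$-summable if $|D|^{-d}\in\mathcal L^{(1,\infty)}$ (Dixmier ideal); $Tr_\omega$ is the Dixmier trace. The constants $\alpha,\beta$ are positive reals. Dirac forms: $\Omega_D^1(\mathcal A)=\{\sum a_j[D,b_j]\}$, $\pi(\Omega^2(\mathcal A))=\{\sum a_j[D,b_j][D,c_j]\}$, $\pi(dJ_0^1(\mathcal A))=\{\sum[D,b_j][D,c_j]:\sum b_j[D,c_j]=0\}$ (all inside $\mathcal B(\mathcal H)$), $\Omega_D^2(\mathcal A)=\pi(\Omega^2(\mathcal A))/\pi(dJ_0^1(\mathcal A))$. Differentials: $d:\mathcal A\to\Omega^1_D(\mathcal A)$, $a\mapsto[D,a]$, and $d:\Omega_D^1(\mathcal A)\to\Omega_D^2(\mathcal A)$, $a[D,b]\mapsto$ class of $[D,a][D,b]$; convention $(da)^*=-d(a^* )$. Product triple: $\mathcal A=\mathcal A_1\otimes\mathcal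 A_2$, $\mathcal H=\mathcal H_1\otimes\mathcal H_2$, $D=D_1\otimes1+\gamma_1\otimes D_2$, $\gamma=\gamma_1\otimes\gamma_2$; it is $(k+\ell)$-summable. $\Omega^1_D(\mathcal A)=\Omega^1_{D_1}(\mathcal A_1)\otimes\mathcal A_2\oplus\mathcal A_1\otimes\Omega^1_{D_2}(\mathcal A_2)$, where $(\omega_1\otimes a_2,a_1\otimes\omega_2)$ stands for $\omega_1\otimes a_2+\gamma_1a_1\otimes\omega_2$. Modules are right modules. A Hermitian finitely generated projective module is written $\mathcal E=p\mathcal A^q$ with $p=p^2=p^*\in M_q(\mathcal A)$ and $\langle\xi,\eta\rangle_{\mathcal A}=\sum\xi_j^*\eta_j$. A compatible connection ($\nabla\in C(\mathcal E)$) is a $\mathbb C$-linear map $\nabla:\mathcal E\to\mathcal E\otimes_{\mathcal A}\Omega_D^1(\mathcal A)$ with $\nabla(\xi a)=(\nabla\xi)a+\xi\otimes da$ and $\langle\xi,\nabla\eta\rangle-\langle\nabla\xi,\eta\rangle=d\langle\xi,\eta\rangle_{\mathcal A}$, where if $\nabla\xi=\sum\xi_j\otimes\omega_j$ then $\langle\nabla\xi,\eta\rangle=\sum\omega_j^*\langle\xi_j,\eta\rangle_{\mathcal A}$ and $\langle\eta,\nabla\xi\rangle=\sum\langle\eta,\xi_j\rangle_{\mathcal A}\omega_j$. It extends to $\widetilde\nabla:\mathcal E\otimes_{\mathcal A}\Omega_D^1\to\mathcal E\otimes_{\mathcal A}\Omega_D^2$, $\widetilde\nabla(\xi\otimes\omega)=(\nabla\xi)\omega+\xi\otimes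 d\omega$; the curvature is $\varTheta=\widetilde\nabla\circ\nabla\in\mathcal Hom_{\mathcal A}(\mathcal E,\mathcal E\otimes_{\mathcal A}\Omega_D^2(\mathcal A))$. For a $d$-summable triple, $\pi(\Omega^2(\mathcal A))$ has the inner product $\langle T_1,T_2\rangle=Tr_\omega(T_1^*T_2|D|^{-d})$; $P$ is the orthogonal projection, in the Hilbert space completion, onto the orthogonal complement of $\pi(dJ_0^1(\mathcal A))$, and $\langle[T_1],[T_2]\rangle_{\Omega_D^2}=\langle PT_1,PT_2\rangle$. View $\mathcal Hom_{\mathcal A}(p\mathcal A^q,p(\Omega_D^2)^q)\subseteq\mathcal Hom_{\mathcal A}(\mathcal A^q,(\Omega_D^2)^q)$ (precomposing with $p$), put $\langle\langle\phi,\psi\rangle\rangle=\sum_{k,i=1}^q\langle(\phi(e_k))_i,(\psi(e_k))_i\rangle_{\Omega_D^2}$, and $\mathcal{YM}(\nabla)=\langle\langle\varTheta,\varTheta\rangle\rangle$. The module $\mathcal E=\mathcal E_1\otimes\mathcal E_2=(p_1\otimes p_2)\mathcal A^{mn}$ carries the Hermitian structure $\langle e_1\otimes e_2,e_1'\otimes e_2'\rangle=\langle e_1,e_1'\rangle\otimes\langle e_2,e_2'\rangle$, and $\nabla(e_1\otimes e_2)=\nabla_1(e_1)\otimes e_2+e_1\otimes\nabla_2(e_2)$, using the canonical isomorphisms $\mathcal E\otimes_{\mathcal A}(\Omega^1_{D_1}(\mathcal A_1)\otimes\mathcal A_2)\cong(\mathcal E_1\otimes_{\mathcal A_1}\Omega^1_{D_1}(\mathcal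 A_1))\otimes\mathcal E_2$ and $\mathcal E\otimes_{\mathcal A}(\mathcal A_1\otimes\Omega^1_{D_2}(\mathcal A_2))\cong\mathcal E_1\otimes(\mathcal E_2\otimes_{\mathcal A_2}\Omega^1_{D_2}(\mathcal A_2))$. *)

(* Defs.v *)
From HB Require Import structures.
From mathcomp Require Import all_boot all_order all_algebra.
From mathcomp Require Import all_classical all_reals all_analysis.
From mathcomp Require Import complex mxtens.

Set Implicit Arguments.
Unset Strict Implicit.
Unset Printing Implicit Defensive.

Import Order.TTheory GRing.Theory Num.Theory numFieldNormedType.Exports.

Local Open Scope classical_set_scope.
Local Open Scope ring_scope.
Local Open Scope complex_scope.

(* The set of finite sums of elements of S.  Applied to a set S of pairs, it
   gives the graph of the (possibly multivalued) additive extension of S. *)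
Definition finsums (V : nmodType) (S : set V) : set V :=
  [set x | exists n (f : 'I_n -> V), (forall i, S (f i)) /\ x = \sum_i f i].

Record hilbertSpace (R : realType) := HilbertSpace {
  hs_sort :> completeNormedModType R[i] ;
  hs_dot : {dot hs_sort for Num.conj} ;
  hs_normE : forall x : hs_sort, `|x| ^+ 2 = hs_dot x x }.

(* Conjugate-linear in the first variable, linear in the second one (forms of
   type {dot _ for _} are linear in their first variable). *)
Definition inner (R : realType) (H : hilbertSpace R) (x y : H) : R[i] :=
  hs_dot H y x.

Definition separable_space (R : realType) (H : hilbertSpace R) :=
  exists2 S : set H, countable S & dense S.

Definition orthc (R : realType) (H : hilbertSpace R) (S : set H) : set H :=
  [set x | forall y, S y -> inner y x = 0].

(* Throughout, xget selects an object determined by its characterization; the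
   default value is not meaningful. *)
Definition oproj (R : realType) (H : hilbertSpace R) (M : set H) (u : H) : H :=
  xget 0 [set w : H | M w /\ orthc M (u - w)].

Record boundedOp (R : realType) (H : hilbertSpace R) := BoundedOp {
  bop_fun :> H -> H ;
  bop_linear : forall (c : R[i]) x y, bop_fun (c *: x + y) = c *: bop_fun x + bop_fun y ;
  bop_continuous : continuous bop_fun }.

Notation "''B' ( H )" := (boundedOp H) (at level 8, format "''B' ( H )").

Section BoundedOpAlgebra.
Context {R : realType} {H : hilbertSpace R}.
Implicit Types (S T U : 'B(H)).

Lemma bopP S T : (forall x, S x = T x) -> S = T.
Proof.
case: S T => [f lf cf] [g lg cg] /= fg.
have {}fg : f = g by apply/funext.
by subst g; congr BoundedOp; exact: Prop_irrelevance.
Qed.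

HB.instance Definition _ := gen_eqMixin 'B(H).
HB.instance Definition _ := gen_choiceMixin 'B(H).

Lemma bop0 T : T 0 = 0.
Proof.
have := bop_linear T 1 0 0; rewrite !scale1r addr0 => /eqP.
by rewrite -subr_eq0 opprD addrA subrr sub0r oppr_eq0 => /eqP.
Qed.

Lemma bopD T x y : T (x + y) = T x + T y.
Proof. by rewrite -{1}[x]scale1r bop_linear scale1r. Qed.

Definition bop_zero : 'B(H).
Proof.
apply: (@BoundedOp R H (fun=> 0)) => [c x y|x]; first by rewrite scaler0 addr0.
exact: cvg_cst.
Defined.

Definition bop_opp T : 'B(H).
Proof.
apply: (@BoundedOp R H (fun x => - T x)) => [c x y|x].
  by rewrite bop_linear opprD scalerN.
by apply: cvgN; exact: bop_continuous.
Defined.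

Definition bop_add S T : 'B(H).
Proof.
apply: (@BoundedOp R H (fun x => S x + T x)) => [c x y|x].
  by rewrite !bop_linear scalerDr addrACA.
by apply: cvgD; exact: bop_continuous.
Defined.

Definition bop_scale (c : R[i]) T : 'B(H).
Proof.
apply: (@BoundedOp R H (fun x => c *: T x)) => [k x y|x].
  by rewrite bop_linear scalerDr !scalerA mulrC.
by apply: cvgZl_tmp; exact: bop_continuous.
Defined.

Definition bop_one : 'B(H).
Proof. by apply: (@BoundedOp R H idfun) => // x; exact: cvg_id. Defined.

Definition bop_mul S T : 'B(H).
Proof.
apply: (@BoundedOp R H (S \o T)) => [k x y|x]; first by rewrite /= !bop_linear.
by apply: continuous_comp; exact: bop_continuous.
Defined.

Fact bop_addA : associative bop_add.
Proof. by move=> S T U; apply: bopP => x /=; rewrite addrA. Qed.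
Fact bop_addC : commutative bop_add.
Proof. by move=> S T; apply: bopP => x /=; rewrite addrC. Qed.
Fact bop_add0 : left_id bop_zero bop_add.
Proof. by move=> S; apply: bopP => x /=; rewrite add0r. Qed.
Fact bop_addN : left_inverse bop_zero bop_opp bop_add.
Proof. by move=> S; apply: bopP => x /=; rewrite addNr. Qed.

HB.instance Definition _ :=
  GRing.isZmodule.Build 'B(H) bop_addA bop_addC bop_add0 bop_addN.

Fact bop_mulA : associative bop_mul.
Proof. by move=> S T U; apply: bopP. Qed.
Fact bop_mul1 : left_id bop_one bop_mul.
Proof. by move=> S; apply: bopP. Qed.
Fact bop_mulr1 : right_id bop_one bop_mul.
Proof. by move=> S; apply: bopP. Qed.
Fact bop_mulDl : left_distributive bop_mul +%R.
Proof. by move=> S T U; apply: bopP. Qed.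
Fact bop_mulDr : right_distributive bop_mul +%R.
Proof. by move=> S T U; apply: bopP => x /=; exact: bopD. Qed.

HB.instance Definition _ := GRing.Zmodule_isPzRing.Build 'B(H)
  bop_mulA bop_mul1 bop_mulr1 bop_mulDl bop_mulDr.

Fact bop_scaleA c d T : bop_scale c (bop_scale d T) = bop_scale (c * d) T.
Proof. by apply: bopP => x /=; rewrite scalerA. Qed.
Fact bop_scale1 : left_id 1 bop_scale.
Proof. by move=> S; apply: bopP => x /=; rewrite scale1r. Qed.
Fact bop_scaleDr : right_distributive bop_scale +%R.
Proof. by move=> c S T; apply: bopP => x /=; rewrite scalerDr. Qed.
Fact bop_scaleDl T : {morph bop_scale^~ T : c d / c + d}.
Proof. by move=> c d; apply: bopP => x /=; rewrite scalerDl. Qed.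

HB.instance Definition _ := GRing.Zmodule_isLmodule.Build R[i] 'B(H)
  bop_scaleA bop_scale1 bop_scaleDr bop_scaleDl.

Definition adj T : 'B(H) :=
  xget 0 [set S : 'B(H) | forall x y, inner (T x) y = inner x (S y)].

Definition positive_op T := forall x, 0 <= inner x (T x).

Definition compact_op T := precompact (T @` [set x | `|x| <= 1]).

Definition opnorm T : R := sup [set complex.Re `|T x| | x in [set x | `|x| <= 1]].

Definition rank_le (n : nat) T := exists v : 'I_n -> H,
  forall x, exists c : 'I_n -> R[i], T x = \sum_i c i *: v i.

Definition singular_value T (n : nat) : R :=
  inf [set opnorm (T - F) | F in rank_le n].

End BoundedOpAlgebra.

Definition bounded_seq (R : realType) (u : nat -> R) :=
  exists M, forall n, `|u n| <= M.

(* Sequences are indexed from 1 (the term u 0 is dummy): the last condition is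
   Lim(u1,u1,u2,u2,...) = Lim(u1,u2,...). *)
Record dixmier_limit (R : realType) (omega : (nat -> R) -> R) : Prop := {
  dl_linear : forall (c : R) u v, bounded_seq u -> bounded_seq v ->
    omega (fun n => c * u n + v n) = c * omega u + omega v ;
  dl_pos : forall u, bounded_seq u -> (forall n, 0 <= u n) -> 0 <= omega u ;
  dl_lim : forall u (l : R), u n @[n --> \oo] --> l -> omega u = l ;
  dl_dilation : forall u, bounded_seq u ->
    omega (fun n => u (uphalf n)) = omega u }.

Section Dixmier.
Context {R : realType} {H : hilbertSpace R}.
Variable omega : (nat -> R) -> R.
Implicit Types T : 'B(H).

(* ln 0 = ln 1 = 0 and division by 0 yields 0. *)
Definition log_mean T (N : nat) : R :=
  (\sum_(n < N) singular_value T n) / ln N%:R.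

Definition dixmier_ideal : set 'B(H) :=
  [set T | compact_op T /\ bounded_seq (log_mean T)].

Definition dixmier_cone : set 'B(H) :=
  [set T | dixmier_ideal T /\ positive_op T].

(* On the positive cone Tr_omega T = omega (log_mean T); it is then extended by
   linearity to the ideal. *)
Definition dixmier_trace T : R[i] :=
  xget 0 [set c | exists T1 T2 T3 T4,
    [/\ dixmier_cone T1, dixmier_cone T2, dixmier_cone T3 & dixmier_cone T4] /\
    T = (T1 - T2) + 'i *: (T3 - T4) /\
    c = (omega (log_mean T1) - omega (log_mean T2))
        +i* (omega (log_mean T3) - omega (log_mean T4))].

End Dixmier.

Section Unbounded.
Context {R : realType} {H : hilbertSpace R}.
Implicit Types D : set (H * H).

Definition domain D : set H := [set x | exists y, D (x, y)].

Definition adjoint_graph D : set (H * H) :=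
  [set z | forall u v, D (u, v) -> inner v z.1 = inner u z.2].

(* A graph equal to its adjoint is automatically a linear subspace, and it is
   single-valued as soon as its domain is dense. *)
Definition self_adjoint D := dense (domain D) /\ D = adjoint_graph D.

Definition is_resolvent D (z : R[i]) (T : 'B(H)) :=
  (forall y, D (T y, y + z *: T y)) /\
  (forall x y, D (x, y) -> T (y - z *: x) = x).

Definition compact_resolvent D :=
  forall z T, is_resolvent D z T -> compact_op T.

(* T extends [D, a]. *)
Definition is_commutator D (a T : 'B(H)) :=
  forall x y, D (x, y) -> D (a x, a y + T x).

Definition commutator D (a : 'B(H)) : 'B(H) :=
  xget 0 [set T : 'B(H) | is_commutator D a T].

(* |D|^-d for D self-adjoint with compact resolvent (so that its eigenvectors
   span a dense subspace), with the usual convention that it vanishes on the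
   finite-dimensional kernel of D. *)
Definition abs_negpow D (d : R) : 'B(H) :=
  xget 0 [set T : 'B(H) | forall (lam : R) x, D (x, lam%:C *: x) ->
    T x = if lam == 0 then 0 else (`|lam| `^ (- d))%:C *: x].

End Unbounded.

Record cstarAlgebra (R : realType) := CstarAlgebra {
  cs_sort :> completeNormedModType R[i] ;
  cs_mul : cs_sort -> cs_sort -> cs_sort ;
  cs_one : cs_sort ;
  cs_star : cs_sort -> cs_sort ;
  cs_mulA : associative cs_mul ;
  cs_mul1 : left_id cs_one cs_mul ;
  cs_mulr1 : right_id cs_one cs_mul ;
  cs_mulPl : forall c a b x, cs_mul (c *: a + b) x = c *: cs_mul a x + cs_mul b x ;
  cs_mulPr : forall c a b x, cs_mul x (c *: a + b) = c *: cs_mul x a + cs_mul x b ;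
  cs_starP : forall c a b, cs_star (c *: a + b) = Num.conj c *: cs_star a + cs_star b ;
  cs_starK : involutive cs_star ;
  cs_starM : forall a b, cs_star (cs_mul a b) = cs_mul (cs_star b) (cs_star a) ;
  cs_normM : forall a b, `|cs_mul a b| <= `|a| * `|b| ;
  cs_normC : forall a, `|cs_mul (cs_star a) a| = `|a| ^+ 2 }.

Section HolomorphicCalculus.
Context {R : realType} {B : cstarAlgebra R}.

Definition is_inverse (a b : B) :=
  cs_mul a b = cs_one B /\ cs_mul b a = cs_one B.

Definition spectrum (a : B) : set R[i]^o :=
  [set z | ~ exists b, is_inverse (z *: cs_one B - a) b].

Definition resolvent (a : B) (z : R[i]) : B :=
  xget 0 [set b : B | is_inverse (z *: cs_one B - a) b].

Definition C1_loop (g : R -> R[i]^o) :=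
  [/\ forall t, derivable (fun s => complex.Re (g s) : R) t 1,
      forall t, derivable (fun s => complex.Im (g s) : R) t 1,
      continuous (derive1 (fun s => complex.Re (g s))),
      continuous (derive1 (fun s => complex.Im (g s)))
    & g 0 = g 1].

Definition velocity (g : R -> R[i]^o) (t : R) : R[i] :=
  derive1 (fun s => complex.Re (g s)) t +i* derive1 (fun s => complex.Im (g s)) t.

Definition contour_integral (g : R -> R[i]^o) (f : R[i] -> R[i]) : R[i] :=
  let h t := f (g t) * velocity g t in
  (\int[lebesgue_measure]_(t in `[0, 1]) complex.Re (h t))
  +i* (\int[lebesgue_measure]_(t in `[0, 1]) complex.Im (h t)).

(* (2 i pi)^-1 times the integral of f along the cycle c *)
Definition cauchy_integral (c : seq (R -> R[i]^o)) (f : R[i] -> R[i]) : R[i] :=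
  (\sum_(g <- c) contour_integral g f) / (0 +i* (pi *+ 2)).

(* The cycle c lies in U minus K, winds once around every point of K and does
   not wind around the points outside U. *)
Definition surrounds (c : seq (R -> R[i]^o)) (K U : set R[i]^o) :=
  [/\ forall i, (i < size c)%N -> C1_loop (nth (fun=> 0) c i),
      forall i t, (i < size c)%N -> 0 <= t <= 1 ->
        (U `\` K) (nth (fun=> 0) c i t),
      forall z, K z -> cauchy_integral c (fun w => (w - z)^-1) = 1
    & forall z, ~ U z -> cauchy_integral c (fun w => (w - z)^-1) = 0].

(* b = f(a) = (2 i pi)^-1 \oint f(z) (z - a)^-1 dz, the B-valued integral being
   taken weakly. *)
Definition is_holomorphic_calculus (a : B) (U : set R[i]^o)
    (f : R[i]^o -> R[i]^o) (b : B) :=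
  exists2 c, surrounds c (spectrum a) U &
    forall phi : B -> R[i]^o, continuous phi ->
      (forall (k : R[i]) x y, phi (k *: x + y) = k * phi x + phi y) ->
      phi b = cauchy_integral c (fun z => f z * phi (resolvent a z)).

Definition stable_holomorphic_calculus (A : set B) :=
  forall a (U : set R[i]^o) (f : R[i]^o -> R[i]^o) b,
    A a -> open U -> spectrum a `<=` U ->
    (forall z, U z -> derivable f z 1) ->
    is_holomorphic_calculus a U f b -> A b.

End HolomorphicCalculus.

(* The algebra is identified with its image in B(H). *)
Record tripleData (R : realType) := TripleData {
  hil : hilbertSpace R ;
  alg : set 'B(hil) ;
  dirac_op : set (hil * hil) }.

Arguments alg {R} _.
Arguments dirac_op {R} _.

Record star_subalgebra (R : realType) (H : hilbertSpace R) (A : set 'B(H)) :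
    Prop := {
  ssa_one : A 1 ;
  ssa_lin : forall (c : R[i]) a b, A a -> A b -> A (c *: a + b) ;
  ssa_mul : forall a b, A a -> A b -> A (a * b) ;
  ssa_adj : forall a, A a -> A (adj a) }.

Record star_embedding (R : realType) (H : hilbertSpace R) (A : set 'B(H))
    (B : cstarAlgebra R) (j : 'B(H) -> B) : Prop := {
  se_one : j 1 = cs_one B ;
  se_lin : forall (c : R[i]) a b, A a -> A b -> j (c *: a + b) = c *: j a + j b ;
  se_mul : forall a b, A a -> A b -> j (a * b) = cs_mul (j a) (j b) ;
  se_star : forall a, A a -> j (adj a) = cs_star (j a) ;
  se_inj : forall a b, A a -> A b -> j a = j b -> a = b }.

Record spectral_triple (R : realType) (X : tripleData R) : Prop := {
  st_separable : separable_space (hil X) ;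
  st_alg : star_subalgebra (alg X) ;
  st_self_adjoint : self_adjoint (dirac_op X) ;
  st_compact_resolvent : compact_resolvent (dirac_op X) ;
  st_commutator : forall a, alg X a ->
    exists T, is_commutator (dirac_op X) a T ;
  st_holomorphic : exists (B : cstarAlgebra R) (j : 'B(hil X) -> B),
    star_embedding (alg X) j /\
    stable_holomorphic_calculus (j @` alg X) }.

Record grading (R : realType) (X : tripleData R) (g : 'B(hil X)) : Prop := {
  gr_adj : adj g = g ;
  gr_sqr : g * g = 1 ;
  gr_comm : forall a, alg X a -> g * a = a * g ;
  gr_anticomm : forall x y, dirac_op X (x, y) -> dirac_op X (g x, - g y) }.

Definition dim_summable (R : realType) (X : tripleData R) (d : R) :=
  dixmier_ideal (abs_negpow (dirac_op X) d).

Section DiracForms.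
Context {R : realType}.
Variable X : tripleData R.
Local Notation A := (alg X).
Local Notation d := (commutator (dirac_op X)).

Definition Omega1 : set 'B(hil X) :=
  finsums [set w | exists a b, [/\ A a, A b & w = a * d b]].

Definition piOmega2 : set 'B(hil X) :=
  finsums [set w | exists a b c, [/\ A a, A b, A c & w = a * d b * d c]].

(* The pairs (sum_j a_j [D, b_j], sum_j [D, a_j] [D, b_j]). *)
Definition d1_graph : set ('B(hil X) * 'B(hil X)) :=
  finsums [set z | exists a b, [/\ A a, A b & z = (a * d b, d a * d b)]].

(* pi(dJ_0^1(A)): the sums of [D, b_j] [D, c_j] with sum_j b_j [D, c_j] = 0. *)
Definition piJ : set 'B(hil X) := [set T | d1_graph (0, T)].

(* The elements of Omega_D^2(A) are the cosets of piJ in piOmega2. *)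
Definition junk_class (T : 'B(hil X)) : set 'B(hil X) := [set T + J | J in piJ].

End DiracForms.

Arguments Omega1 {R} X.
Arguments piOmega2 {R} X.
Arguments d1_graph {R} X.
Arguments piJ {R} X.
Arguments junk_class {R} X.

(* K, together with i : V -> K, is the Hilbert space completion of the subspace
   S of V for the inner product form. *)
Record is_completion (R : realType) (V : lmodType R[i]) (S : set V)
    (form : V -> V -> R[i]) (K : hilbertSpace R) (i : V -> K) : Prop := {
  ic_lin : forall (c : R[i]) u v, S u -> S v -> i (c *: u + v) = c *: i u + i v ;
  ic_inner : forall u v, S u -> S v -> inner (i u) (i v) = form u v ;
  ic_dense : dense (i @` S) }.

Section YangMills.
Context {R : realType}.
Variables (X : tripleData R) (d : R) (omega : (nat -> R) -> R).
Local Notation A := (alg X).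
Local Notation D := (dirac_op X).

Definition form2 (T1 T2 : 'B(hil X)) : R[i] :=
  dixmier_trace omega (adj T1 * T2 * abs_negpow D d).

(* <[T1], [T2]> = <P T1, P T2>, computed on any representatives T1, T2 and in
   any completion of piOmega2. *)
Definition inner_Omega2 (c1 c2 : set 'B(hil X)) : R[i] :=
  xget 0 [set z | exists (K : hilbertSpace R) (i : 'B(hil X) -> K),
    is_completion (piOmega2 X) form2 i /\
    exists T1 T2, [/\ c1 T1, c2 T2 &
      let P := oproj (orthc (i @` piJ X)) in z = inner (P (i T1)) (P (i T2))]].

Section Module.
Variables (q : nat) (p : 'M['B(hil X)]_q).
Implicit Types (xi eta : 'cV['B(hil X)]_q) (T : 'B(hil X)).

Definition mxadj (m n : nat) (M : 'M['B(hil X)]_(m, n)) : 'M['B(hil X)]_(n, m) :=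
  (map_mx adj M)^T.

Definition projection_over :=
  [/\ forall i j, A (p i j), p *m p = p & mxadj p = p].

(* p S^q; for a bimodule S = Omega^1 over A, the module E (x)_A S is identified
   with p S^q through xi (x) w |-> (xi_i w)_i. *)
Definition pmod (S : set 'B(hil X)) : set 'cV['B(hil X)]_q :=
  [set p *m xi | xi in [set xi : 'cV_q | forall i, S (xi i 0)]].

Definition rscale xi T : 'cV['B(hil X)]_q := map_mx (fun x => x * T) xi.

(* sum_i xi_i^* eta_i *)
Definition pairing xi eta : 'B(hil X) := (mxadj xi *m eta) 0 0.

Record compatible_connection (nabla : 'cV['B(hil X)]_q -> 'cV['B(hil X)]_q) :
    Prop := {
  cc_codom : forall xi, pmod A xi -> pmod (Omega1 X) (nabla xi) ;
  cc_lin : forall (c : R[i]) xi eta, pmod A xi -> pmod A eta ->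
    nabla (map_mx ( *:%R c) xi + eta) = map_mx ( *:%R c) (nabla xi) + nabla eta ;
  cc_leibniz : forall xi a, pmod A xi -> A a ->
    nabla (rscale xi a) = rscale (nabla xi) a + rscale xi (commutator D a) ;
  cc_metric : forall xi eta, pmod A xi -> pmod A eta ->
    pairing xi (nabla eta) - pairing (nabla xi) eta
    = commutator D (pairing xi eta) }.

Variable nabla : 'cV['B(hil X)]_q -> 'cV['B(hil X)]_q.

(* sum xi (x) w |-> sum (nabla xi) w + xi (x) dw, where dw is given by any of its
   representatives T. *)
Definition nabla_ext_graph : set ('cV['B(hil X)]_q * 'cV['B(hil X)]_q) :=
  finsums [set z | exists xi w T, [/\ pmod A xi, d1_graph X (w, T) &
    z = (rscale xi w, rscale (nabla xi) w + rscale xi T)]].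

(* Elements of E (x)_A Omega_D^2 = p (Omega_D^2)^q are columns of cosets. *)
Definition nabla_ext (zeta : 'cV['B(hil X)]_q) : 'cV[set 'B(hil X)]_q :=
  map_mx (junk_class X) (xget 0 [set v | nabla_ext_graph (zeta, v)]).

Definition curvature xi : 'cV[set 'B(hil X)]_q := nabla_ext (nabla xi).

(* p e_k = col k p *)
Definition inner_Hom (phi psi : 'cV['B(hil X)]_q -> 'cV[set 'B(hil X)]_q) : R[i] :=
  \sum_(k < q) \sum_(i < q)
    inner_Omega2 (phi (col k p) i 0) (psi (col k p) i 0).

(* The sum is a nonnegative real, being a sum of squared norms. *)
Definition YM : R := complex.Re (inner_Hom curvature curvature).

End Module.
End YangMills.

Arguments projection_over {R} X {q} p.
Arguments compatible_connection {R} X {q} p nabla.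
Arguments YM {R} X d omega {q} p nabla.

Record hilbertTensor (R : realType) (H1 H2 : hilbertSpace R) := HilbertTensor {
  ht_space :> hilbertSpace R ;
  ht_tens : H1 -> H2 -> ht_space ;
  ht_linl : forall (c : R[i]) x x' y,
    ht_tens (c *: x + x') y = c *: ht_tens x y + ht_tens x' y ;
  ht_linr : forall (c : R[i]) x y y',
    ht_tens x (c *: y + y') = c *: ht_tens x y + ht_tens x y' ;
  ht_inner : forall x x' y y',
    inner (ht_tens x y) (ht_tens x' y') = inner x x' * inner y y' ;
  ht_dense : dense (finsums [set z | exists x y, z = ht_tens x y]) }.

Section Product.
Context {R : realType}.
Variables (X1 X2 : tripleData R) (g1 : 'B(hil X1)).
Variable H : hilbertTensor (hil X1) (hil X2).
Local Notation tens := (@ht_tens R _ _ H).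

Definition optens (a1 : 'B(hil X1)) (a2 : 'B(hil X2)) : 'B(H) :=
  xget 0 [set T : 'B(H) | forall x y, T (tens x y) = tens (a1 x) (a2 y)].

(* A1 (x) A2, acting faithfully on H1 (x) H2 *)
Definition prod_alg : set 'B(H) :=
  finsums [set T | exists a1 a2,
    [/\ alg X1 a1, alg X2 a2 & T = optens a1 a2]].

(* D1 (x) 1 + g1 (x) D2 is the closure of the operator given by this formula on
   the algebraic tensor product of the domains. *)
Definition prod_dirac : set (H * H) :=
  closure (finsums [set z : H * H | exists x1 y1 x2 y2,
    [/\ dirac_op X1 (x1, y1), dirac_op X2 (x2, y2) &
        z = (tens x1 x2, tens y1 x2 + tens (g1 x1) y2)]]).

Definition prod_triple : tripleData R :=
  @TripleData R H prod_alg prod_dirac.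

Definition mxtensor (m n : nat) (p1 : 'M['B(hil X1)]_m) (p2 : 'M['B(hil X2)]_n) :
    'M['B(H)]_(m * n) :=
  \matrix_(i, j) optens (p1 (mxtens_unindex i).1 (mxtens_unindex j).1)
                        (p2 (mxtens_unindex i).2 (mxtens_unindex j).2).

Definition coltensor (m n : nat) (e1 : 'cV['B(hil X1)]_m) (e2 : 'cV['B(hil X2)]_n) :
    'cV['B(H)]_(m * n) :=
  \col_i optens (e1 (mxtens_unindex i).1 0) (e2 (mxtens_unindex i).2 0).

(* nabla1 (x) 1 + 1 (x) nabla2, a form w2 on the second factor being represented
   on H by g1 (x) w2. *)
Definition prod_connection (m n : nat)
    (p1 : 'M['B(hil X1)]_m) (p2 : 'M['B(hil X2)]_n)
    (nabla1 : 'cV['B(hil X1)]_m -> 'cV['B(hil X1)]_m)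
    (nabla2 : 'cV['B(hil X2)]_n -> 'cV['B(hil X2)]_n)
    (xi : 'cV['B(H)]_(m * n)) : 'cV['B(H)]_(m * n) :=
  xget 0 [set zeta | finsums [set z | exists e1 e2,
    [/\ pmod p1 (alg X1) e1, pmod p2 (alg X2) e2 &
        z = (coltensor e1 e2,
             coltensor (nabla1 e1) e2
             + coltensor (map_mx ( *%R g1) e1) (nabla2 e2))]] (xi, zeta)].

End Product.

Arguments prod_triple {R} X1 X2 g1 H.
Arguments mxtensor {R X1 X2} H {m n} p1 p2.
Arguments prod_connection {R X1 X2} g1 H {m n} p1 p2 nabla1 nabla2 xi.

(* Only meaningful for 0 < x. *)
Definition Gamma (R : realType) (x : R) : R :=
  \int[lebesgue_measure]_(t in `]0, +oo[) (t `^ (x - 1) * expR (- t)).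

(* Main.v *)
Require Import Defs.
From mathcomp Require Import all_boot all_order all_algebra.
From mathcomp Require Import all_classical all_reals all_analysis.
From mathcomp Require Import complex mxtens.

Import Order.TTheory GRing.Theory Num.Theory numFieldNormedType.Exports.
Local Open Scope classical_set_scope.
Local Open Scope ring_scope.

(** Additivity is a Pythagorean relation: it makes the square root of the
    Yang-Mills functional of the product connection the hypotenuse of a right
    triangle with legs [sqrt alpha * sqrt YM1] and [sqrt beta * sqrt YM2],
    whereas subadditivity is the triangle inequality for these three lengths.
    Each pair of connections is treated separately: since [alpha] and [beta]
    are positive, their square roots can be merged with those of the Yang-Mills
    values, and what remains is subadditivity of the square root,
    [sqrtr_subadditive], on the two summands. *)

(** Squaring [Num.sqrt x + Num.sqrt y] produces the nonnegative cross term
    [2 * Num.sqrt x * Num.sqrt y] on top of a majorant of [x + y].  The bound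
    holds for every sign of [x] and [y] because [Num.sqrt] is zero on negative
    elements, so that [x <= Num.sqrt x ^+ 2] always. *)
Lemma sqrtr_subadditive (R : rcfType) (x y : R) :
  Num.sqrt (x + y) <= Num.sqrt x + Num.sqrt y.
Proof.
have le_sqr (z : R) : z <= Num.sqrt z ^+ 2.
  have [z0|z0] := leP 0 z; first by rewrite sqr_sqrtr.
  by rewrite (le_trans (ltW z0)) ?sqr_ge0.
have s_ge0 : 0 <= Num.sqrt x + Num.sqrt y by rewrite addr_ge0 ?sqrtr_ge0.
rewrite -(ger0_norm s_ge0) -sqrtr_sqr ler_wsqrtr // sqrrD.
rewrite addrAC; apply: (le_trans (lerD (le_sqr x) (le_sqr y))).
by rewrite lerDl mulrn_wge0 // mulr_ge0 ?sqrtr_ge0.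
Qed.

Theorem corollary3p20 (R : realType)
  (omega : (nat -> R) -> R) (homega : dixmier_limit omega)
  (k l : R) (hk : 0 < k) (hl : 0 < l)
  (X1 X2 : tripleData R) (g1 : 'B(hil X1)) (g2 : 'B(hil X2))
  (hX1 : spectral_triple X1) (hX2 : spectral_triple X2)
  (hg1 : grading g1) (hg2 : grading g2)
  (hsum1 : dim_summable X1 k) (hsum2 : dim_summable X2 l)
  (H : hilbertTensor (hil X1) (hil X2))
  (m n : nat) (p1 : 'M['B(hil X1)]_m) (p2 : 'M['B(hil X2)]_n)
  (hp1 : projection_over X1 p1) (hp2 : projection_over X2 p2)
  (alpha beta : R)
  (alphaE : alpha =
     n%:R * Gamma (k / 2 + 1) * Gamma (l / 2 + 1) / Gamma ((k + l) / 2 + 1)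
     * complex.Re (dixmier_trace omega (abs_negpow (dirac_op X2) l)))
  (betaE : beta =
     m%:R * Gamma (k / 2 + 1) * Gamma (l / 2 + 1) / Gamma ((k + l) / 2 + 1)
     * complex.Re (dixmier_trace omega (abs_negpow (dirac_op X1) k)))
  (alpha_gt0 : 0 < alpha) (beta_gt0 : 0 < beta) :
  let X := prod_triple X1 X2 g1 H in
  let p := mxtensor H p1 p2 in
  (forall nabla1 nabla2,
     compatible_connection X1 p1 nabla1 -> compatible_connection X2 p2 nabla2 ->
     YM X (k + l) omega p (prod_connection g1 H p1 p2 nabla1 nabla2)
     = alpha * YM X1 k omega p1 nabla1 + beta * YM X2 l omega p2 nabla2) ->
  (forall nabla1 nabla2,
     compatible_connection X1 p1 nabla1 -> compatible_connection X2 p2 nabla2 ->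
     Num.sqrt (YM X (k + l) omega p (prod_connection g1 H p1 p2 nabla1 nabla2))
     <= Num.sqrt alpha * Num.sqrt (YM X1 k omega p1 nabla1)
        + Num.sqrt beta * Num.sqrt (YM X2 l omega p2 nabla2)).
Proof.
move=> X p additive nabla1 nabla2 c1 c2.
rewrite (additive _ _ c1 c2) -(sqrtrM _ (ltW alpha_gt0)) -(sqrtrM _ (ltW beta_gt0)).
exact: sqrtr_subadditive.
Qed.
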